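(* For positive integers $n,k,r$, the dimension of $\mathcal{A}_{r,k}(n)$ is equal to the coefficient of $z^nq^rt^r$ in $$\prod_{i\ge0}\prod_{j\ge0}\frac{1}{\left(1-zq^it^j\right)^{\binom{k+i-1}{i}\binom{k+j-1}{j}}}.$$
   Context: $\mathcal{P}^r(V_{n,k})$ is the space of homogeneous polynomials of degree $r$ over $\mathbb{C}$ in the commuting variables $x_{ij}$, $1\le i\le n$, $1\le j\le k$. The symmetric group $S_n$ acts by $\sigma\cdot x_{i_1j_1}\cdots x_{i_rj_r}=x_{\sigma(i_1)j_1}\cdots x_{\sigma(i_r)j_r}$. $\mathcal{A}_{r,k}(n)=\mathrm{End}_{\mathbb{C}S_n}(\mathcal{P}^r(V_{n,k}))$ is the $\mathbb{C}$-algebra of linear endomorphisms commuting with this action. *)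

(* Defs.v *)
From HB Require Import structures.
From mathcomp Require Import all_boot all_order all_algebra all_fingroup.
From mathcomp Require Import boolp reals complex mpoly.

Set Implicit Arguments.
Unset Strict Implicit.
Unset Printing Implicit Defensive.
Import GRing.Theory.
Local Open Scope ring_scope.

Record fps (R : Type) := Fps { fps_coef :> nat -> R }.

Lemma fpsP (R : Type) (p q : fps R) : p =1 q <-> p = q.
Proof.
by split=> [|-> //]; case: p q => [p] [q] /= pq; congr Fps; apply/funext.
Qed.

HB.instance Definition _ (R : Type) := gen_eqMixin (fps R).
HB.instance Definition _ (R : Type) := gen_choiceMixin (fps R).

Section FpsRing.
Variable R : comNzRingType.
Implicit Types p q s : fps R.

Definition fpsC (c : R) : fps R := Fps (fun n => c *+ (n == 0%N)).
Definition fpsX : fps R := Fps (fun n => (n == 1%N)%:R).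

Definition fps_add p q := Fps (fun n => p n + q n).
Definition fps_opp p := Fps (fun n => - p n).
Definition fps_mul p q := Fps (fun n => \sum_(i < n.+1) p i * q (n - i)%N).

Fact fps_addA : associative fps_add.
Proof. by move=> p q s; apply/fpsP => n /=; rewrite addrA. Qed.
Fact fps_addC : commutative fps_add.
Proof. by move=> p q; apply/fpsP => n /=; rewrite addrC. Qed.
Fact fps_add0 : left_id (fpsC 0) fps_add.
Proof. by move=> p; apply/fpsP => n /=; rewrite mul0rn add0r. Qed.
Fact fps_addN : left_inverse (fpsC 0) fps_opp fps_add.
Proof. by move=> p; apply/fpsP => n /=; rewrite mul0rn addNr. Qed.

HB.instance Definition _ :=
  GRing.isZmodule.Build (fps R) fps_addA fps_addC fps_add0 fps_addN.

Let trunc m p : {poly R} := \poly_(i < m.+1) p i.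

Let fps_mulE m p q n : (n <= m)%N ->
  fps_mul p q n = (trunc m p * trunc m q)`_n.
Proof.
move=> le_nm; rewrite coefM; apply: eq_bigr => i _.
have le_im : (i <= m)%N := leq_trans (leq_ord i) le_nm.
by rewrite !coef_poly !ltnS le_im (leq_trans (leq_subr i n) le_nm).
Qed.

Fact fps_mulC : commutative fps_mul.
Proof. by move=> p q; apply/fpsP => n; rewrite !(@fps_mulE n) // mulrC. Qed.

Fact fps_mulA : associative fps_mul.
Proof.
move=> p q s; apply/fpsP => n; rewrite !(@fps_mulE n) //.
transitivity (trunc n p * (trunc n q * trunc n s))`_n.
  rewrite !coefM; apply: eq_bigr => i _; congr (_ * _).
  by rewrite coef_poly ltnS leq_subr (@fps_mulE n) // leq_subr.
rewrite mulrA !coefM; apply: eq_bigr => i _; congr (_ * _).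
by rewrite [RHS]coef_poly ltn_ord (@fps_mulE n) // leq_ord.
Qed.

Fact fps_mul1 : left_id (fpsC 1) fps_mul.
Proof.
move=> p; apply/fpsP => n /=; rewrite big_ord_recl /= mul1r subn0.
by rewrite big1 ?addr0 // => i _; rewrite mul0r.
Qed.

Fact fps_mulDl : left_distributive fps_mul fps_add.
Proof.
move=> p q s; apply/fpsP => n /=; rewrite -big_split /=.
by apply: eq_bigr => i _; rewrite mulrDl.
Qed.

Fact fps_oner_neq0 : fpsC 1 != 0.
Proof. by apply/eqP => /fpsP/(_ 0%N)/eqP; rewrite /= oner_eq0. Qed.

HB.instance Definition _ := GRing.Zmodule_isComNzRing.Build (fps R)
  fps_mulA fps_mulC fps_mul1 fps_mulDl fps_oner_neq0.

Definition fps_unit : {pred fps R} := fun p => `[< exists q, q * p = 1 >].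
Definition fps_inv p : fps R :=
  if pselect (exists q, q * p = 1) is left ex then sval (cid ex) else p.

Fact fps_mulV : {in fps_unit, left_inverse 1 fps_inv *%R}.
Proof.
move=> p /asboolP up; rewrite /fps_inv; case: pselect => // ex.
by case: (cid ex).
Qed.

Fact fps_unitP p q : q * p = 1 -> fps_unit p.
Proof. by move=> qp1; apply/asboolP; exists q. Qed.

Fact fps_inv_out : {in [predC fps_unit], fps_inv =1 id}.
Proof. by move=> p /asboolPn nup; rewrite /fps_inv; case: pselect. Qed.

HB.instance Definition _ := GRing.ComNzRing_hasMulInverse.Build (fps R)
  fps_mulV fps_unitP fps_inv_out.

End FpsRing.

(* Coefficients are outermost first: [f a b c] is the coefficient of
   z^a q^b t^c in [f]. *)
Definition fps3 := fps (fps (fps int)).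
HB.instance Definition _ := GRing.ComUnitRing.on fps3.

Definition zvar : fps3 := fpsX _.
Definition qvar : fps3 := fpsC (fpsX _).
Definition tvar : fps3 := fpsC (fpsC (fpsX _)).

Definition fps3_cvg (u : nat -> fps3) (f : fps3) : Prop :=
  forall a b c, exists N, forall M, (N <= M)%N -> u M a b c = f a b c.

Definition has_infprod (F : nat -> fps3) (f : fps3) : Prop :=
  fps3_cvg (fun M => \prod_(i < M) F i) f.

(* Junk value 0 for a product that does not converge. *)
Definition infprod (F : nat -> fps3) : fps3 :=
  if pselect (exists f, has_infprod F f) is left ex then sval (cid ex) else 0.

Lemma fps3_cvg_unique u f g : fps3_cvg u f -> fps3_cvg u g -> f = g.
Proof.
move=> uf ug; apply/fpsP => a; apply/fpsP => b; apply/fpsP => c.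
have [[N uN] [N' uN']] := (uf a b c, ug a b c).
by rewrite -(uN _ (leq_maxl N N')) -(uN' _ (leq_maxr N N')).
Qed.

Lemma infprodE F f : has_infprod F f -> infprod F = f.
Proof.
move=> Ff; rewrite /infprod; case: pselect => [ex|[]]; last by exists f.
by case: (cid ex) => g /= Fg; apply: fps3_cvg_unique Fg Ff.
Qed.

(* The library has this only for a successor number of variables. *)
Fact dhomog_vect_axiom (F : fieldType) (N r : nat) :
  Vector.axiom 'C((N + r).-1, r) (dhomog N F r).
Proof.
case: N => [|N]; last first.
  by rewrite addSn /= addnC; exact: dhomog_vecaxiom.
case: r => [|d] /=.
  rewrite bin0; exists (fun p => const_mx (val p)@_0%MM) => [a p q|].
    by apply/rowP => i; rewrite !mxE /= mcoeffD mcoeffZ.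
  have homC (c : F) : c%:MP_[0] \is 0.-homog by exact: nvar0_homog.
  exists (fun v : 'cV_1 => DHomog (homC (v 0 0))) => [p|v].
    by apply/val_inj; rewrite /= mxE -nvar0_mpolyC.
  by apply/rowP => i; rewrite !mxE /= mcoeffC eqxx mulr1 !ord1.
rewrite bin_small //; exists (fun=> 0) => [a p q|].
  by rewrite scaler0 addr0.
exists (fun=> 0) => [p|v]; last by apply/rowP => -[].
apply/val_inj/mpolyP => m; rewrite mcoeff0; apply/esym.
apply: (dhomog_nemf_coeff (valP p)).
by rewrite [m]nvar0_mnmE mf0.
Qed.


Section HomogeneousPolynomials.
Variables (F : fieldType) (n k : nat).

(* The n * k variables of [{mpoly F[n * k]}] are indexed by pairs through
   [mxvec_index]. *)
Definition xvar (i : 'I_n) (j : 'I_k) : {mpoly F[n * k]} :=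
  'X_(mxvec_index i j).

(* Substitution of x_(s i, j) for x_(i, j). *)
Definition poly_act (s : 'S_n) (p : {mpoly F[n * k]}) : {mpoly F[n * k]} :=
  p \mPo [tuple mxvec (\matrix_(i, j) xvar (s i) j) 0 l | l < n * k].

Lemma poly_act_xvar s i j : poly_act s (xvar i j) = xvar (s i) j.
Proof.
by rewrite /poly_act /xvar comp_mpolyXU -tnth_nth tnth_mktuple mxvecE mxE.
Qed.

Lemma poly_act_homog s r p : p \is r.-homog -> poly_act s p \is r.-homog.
Proof.
move=> /dhomogP hp; rewrite /poly_act comp_mpolyEX big_seq.
apply: rpred_sum => m /hp /= <-; apply: rpredZ; rewrite comp_mpolyX mdegE.
apply: (big_ind2 (fun p d => p \is d.-homog)) => [|p1 d1 p2 d2|l _].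
- exact: dhomog1.
- exact: dhomogM.
rewrite tnth_mktuple; case/mxvec_indexP: l => i j; rewrite mxvecE mxE.
have /(dhomogMn (m (mxvec_index i j))) : xvar (s i) j \is 1.-homog.
  by rewrite dhomogX /= mdeg1.
by rewrite mul1n.
Qed.

Variable r : nat.

Definition hpoly : Type := dhomog (n * k) F r.
HB.instance Definition _ := GRing.Lmodule.on hpoly.

HB.instance Definition _ :=
  Lmodule_hasFinDim.Build F hpoly (dhomog_vect_axiom F (n * k) r).

Definition hpoly_act (s : 'S_n) (p : hpoly) : hpoly :=
  DHomog (poly_act_homog s (valP p)).

Fact hpoly_act_is_linear s : linear (hpoly_act s).
Proof. by move=> a p q; apply/val_inj; rewrite /= /poly_act linearP. Qed.

HB.instance Definition _ s :=
  GRing.isLinear.Build F hpoly hpoly _ (hpoly_act s) (hpoly_act_is_linear s).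

Definition act_commutator (s : 'S_n) (f : 'End(hpoly)) : 'End(hpoly) :=
  ((f \o linfun (hpoly_act s)) - (linfun (hpoly_act s) \o f))%VF.

Fact act_commutator_is_linear s : linear (act_commutator s).
Proof.
move=> a f g; apply/lfunP => p.
rewrite !(add_lfunE, opp_lfunE, scale_lfunE, comp_lfunE) linearP /=.
by rewrite scalerBr opprD addrACA.
Qed.

HB.instance Definition _ s :=
  GRing.isLinear.Build F 'End(hpoly) 'End(hpoly) _ (act_commutator s)
    (act_commutator_is_linear s).

Definition equivariant_End : {vspace 'End(hpoly)} :=
  (\bigcap_(s : 'S_n) lker (linfun (act_commutator s)))%VS.

Lemma equivariant_EndP (f : 'End(hpoly)) :
  reflect (forall s p, f (hpoly_act s p) = hpoly_act s (f p))
          (f \in equivariant_End).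
Proof.
apply: (iffP subv_bigcapP) => [fA s p|fA s _].
  move: (fA s isT); rewrite -memvE memv_ker lfunE /= subr_eq0 => /eqP/lfunP/(_ p).
  by rewrite !comp_lfunE !lfunE.
rewrite -memvE memv_ker lfunE /= subr_eq0; apply/eqP/lfunP => p.
by rewrite !comp_lfunE !lfunE /= fA.
Qed.

End HomogeneousPolynomials.

(* Main.v *)
(** S_n permutes the monomial basis of P^r(V_{n,k}), so an equivariant
    endomorphism is a matrix constant on the orbits of pairs of monomials, and
    the dimension is the number of these orbits. A monomial is an n-tuple of
    exponent vectors in N^k (its rows), hence an orbit of pairs is a multiset of
    n elements of N^k x N^k whose components have total degrees r and r.
    Such multisets are counted by the product of 1 / (1 - z q^|a| t^|b|) over
    all (a, b), where |a| = i for 'C(k + i - 1, i) vectors a. *)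
From HB Require Import structures.
Require Import Defs.
From mathcomp Require Import all_boot all_order all_algebra all_fingroup.
From mathcomp Require Import boolp reals complex mpoly.

Set Implicit Arguments.
Unset Strict Implicit.
Unset Printing Implicit Defensive.
Import GRing.Theory.
Local Open Scope ring_scope.

(** * Truncated power series *)

Section FpsCoef.
Variable R : comNzRingType.
Implicit Types f g : fps R.

Lemma fps_coefM f g m : (f * g) m = \sum_(i < m.+1) f i * g (m - i)%N.
Proof. by []. Qed.

Lemma fps_coefD f g m : (f + g) m = f m + g m.
Proof. by []. Qed.

Lemma fps_coef0 m : (0 : fps R) m = 0.
Proof. exact: mul0rn. Qed.

Lemma fps_coef1 m : (1 : fps R) m = (m == 0%N)%:R.
Proof. by []. Qed.

Lemma fps_coef_sum I (s : seq I) (P : pred I) (F : I -> fps R) m :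
  (\sum_(i <- s | P i) F i) m = \sum_(i <- s | P i) F i m.
Proof.
apply: (big_morph (fun f : fps R => f m)) => [f g|]; first exact: fps_coefD.
exact: fps_coef0.
Qed.

Lemma fps_coefCM c f m : (fpsC c * f) m = c * f m.
Proof.
rewrite fps_coefM big_ord_recl /= subn0 big1 ?addr0 // => i _.
by rewrite mulr0n mul0r.
Qed.

Lemma fps_coefXM f m : (fpsX R * f) m = if m is m'.+1 then f m' else 0.
Proof.
case: m => [|m]; rewrite fps_coefM big_ord_recl /= mul0r add0r.
  by rewrite big_ord0.
rewrite big_ord_recl /= subn1 mul1r big1 ?addr0 // => i _.
by rewrite mul0r.
Qed.

Lemma fps_coefXn a m : (fpsX R ^+ a) m = (m == a)%:R.
Proof.
elim: a m => [|a IHa] [|m] //; rewrite exprS fps_coefXM //.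
Qed.

Lemma fpsC_mul (c d : R) : fpsC (c * d) = fpsC c * fpsC d.
Proof. by apply/fpsP => m; rewrite fps_coefCM /= mulrnAr. Qed.

Lemma fpsC_exp (c : R) a : fpsC (c ^+ a) = fpsC c ^+ a.
Proof. by elim: a => // a IHa; rewrite !exprS fpsC_mul IHa. Qed.

Lemma fps_coefB f g m : (f - g) m = f m - g m.
Proof. by []. Qed.

(** The geometric series with coefficients [c ^+ a] is the inverse. Invertibility has to be proved,
    since [^-1] returns a non-unit unchanged. *)
Lemma fps_geom_unit (c : R) : 1 - fpsX R * fpsC c \is a GRing.unit.
Proof.
apply/unitrPr; exists (Fps (fun a => c ^+ a)); apply/fpsP => m.
rewrite mulrBl mul1r -mulrA fps_coefB fps_coefXM fps_coef1.
by case: m => [|m]; rewrite ?subr0 // fps_coefCM /= -exprS subrr.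
Qed.

End FpsCoef.

Lemma fps3_coefM (f g : fps3) a b c : (f * g) a b c =
  \sum_(i < a.+1) \sum_(j < b.+1) \sum_(l < c.+1)
    f i j l * g (a - i)%N (b - j)%N (c - l)%N.
Proof.
rewrite fps_coefM !fps_coef_sum; apply: eq_bigr => i _.
by rewrite fps_coefM fps_coef_sum.
Qed.

Lemma fps3_coef_monomial a b c i j l :
  (zvar ^+ a * qvar ^+ b * tvar ^+ c) i j l
    = [&& i == a, j == b & l == c]%:R.
Proof.
rewrite -mulrA mulrC /qvar /tvar -!fpsC_exp -fpsC_mul fps_coefCM fps_coefXn.
case: (i == a); last by rewrite mulr0 !fps_coef0.
rewrite mulr1 mulrC fps_coefCM fps_coefXn.
case: (j == b); last by rewrite mulr0 !fps_coef0.
by rewrite mulr1 fps_coefXn.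
Qed.

(** Congruence modulo the closed ideal generated by [z^(a+1)], [q^(b+1)] and [t^(c+1)]. It lets
    infinite products and inverses be replaced by finite expressions. *)
Definition cong3 a b c (f g : fps3) : Prop := forall i j l,
  (i <= a)%N -> (j <= b)%N -> (l <= c)%N -> f i j l = g i j l.

Section Cong3.
Variables a b c : nat.
Local Notation "f =~ g" := (cong3 a b c f g) (at level 70).

Lemma cong3_refl f : f =~ f. Proof. by []. Qed.

Lemma cong3_sym f g : f =~ g -> g =~ f.
Proof. by move=> fg i j l ia jb lc; rewrite fg. Qed.

Lemma cong3_trans g f h : f =~ g -> g =~ h -> f =~ h.
Proof. by move=> fg gh i j l ia jb lc; rewrite fg ?gh. Qed.

(** A coefficient of a product involves only coefficients of the factors at smaller or equal
    indices, so the bounds are inherited. *)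
Lemma cong3M f f' g g' : f =~ f' -> g =~ g' -> f * g =~ f' * g'.
Proof.
move=> ff' gg' i j l ia jb lc; rewrite !fps3_coefM.
apply: eq_bigr => i' _; apply: eq_bigr => j' _; apply: eq_bigr => l' _.
by rewrite ff' ?gg' ?(leq_trans (leq_subr _ _)) // (leq_trans (leq_ord _)).
Qed.

Lemma cong3_prod I (s : seq I) (P : pred I) F G :
  (forall i, P i -> F i =~ G i) ->
  \prod_(i <- s | P i) F i =~ \prod_(i <- s | P i) G i.
Proof.
move=> FG; apply: (big_rec2 (cong3 a b c)) => [|i f g Pi fg].
  exact: cong3_refl.
exact: cong3M (FG i Pi) fg.
Qed.

Lemma cong3X f g e : f =~ g -> f ^+ e =~ g ^+ e.
Proof.
move=> fg; elim: e => [|e IHe]; first exact: cong3_refl.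
by rewrite !exprS; apply: cong3M fg IHe.
Qed.

(** Multiplying the congruence by the true inverse of [u] shows that an inverse checked only up to
    the bounds is correct up to the bounds. *)
Lemma cong3V u v : u \is a GRing.unit -> u * v =~ 1 -> u^-1 =~ v.
Proof.
move=> uu uv1; rewrite -[u^-1]mulr1 -[v](mulKr uu).
exact: cong3M (cong3_refl _) (cong3_sym uv1).
Qed.

Lemma cong3_partial_prod F N M :
  (forall i, (N <= i)%N -> F i =~ 1) -> (N <= M)%N ->
  \prod_(i < M) F i =~ \prod_(i < N) F i.
Proof.
move=> F1; elim: M => [|M IHM].
  by case: N F1 => // F1 _; apply: cong3_refl.
rewrite leq_eqVlt => /predU1P[<-|leNM]; first exact: cong3_refl.
rewrite big_ord_recr /= -[X in _ =~ X]mulr1.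
exact: cong3M (IHM leNM) (F1 M leNM).
Qed.

End Cong3.

(** * Convergence of infinite products *)

Definition infprod_cauchy (F : nat -> fps3) : Prop :=
  forall a b c, exists N, forall i, (N <= i)%N -> cong3 a b c (F i) 1.

Lemma infprodP F : infprod_cauchy F -> has_infprod F (infprod F).
Proof.
move=> F1; suff [f Ff] : exists f, has_infprod F f by rewrite (infprodE Ff).
have /choice[N NP] : forall x : nat * nat * nat, exists N,
    forall i, (N <= i)%N -> cong3 x.1.1 x.1.2 x.2 (F i) 1.
  by case=> -[a b] c; apply: F1.
(* The limit is built coefficientwise: each one is read off a partial product long enough for that
   coefficient to have stabilised. *)
exists (Fps (fun a => Fps (fun b => Fps (fun c =>
  (\prod_(i < N (a, b, c)) F i) a b c)))) => a b c.
exists (N (a, b, c)) => M leNM /=.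
exact: (cong3_partial_prod (NP (a, b, c)) leNM).
Qed.

Lemma infprod_cong3 F a b c N : infprod_cauchy F ->
  (forall i, (N <= i)%N -> cong3 a b c (F i) 1) ->
  cong3 a b c (infprod F) (\prod_(i < N) F i).
Proof.
move=> /infprodP Fcvg F1 i j l ia jb lc; have [N' NP] := Fcvg i j l.
(* The stabilisation index [N'] depends on the coefficient and may exceed [N]; a partial product of
   length [maxn N N'] agrees with both sides. *)
rewrite -(NP (maxn N N')) ?leq_maxr //.
exact: (cong3_partial_prod F1 (leq_maxl _ _)).
Qed.

(** * Reduction of the double product to a finite product *)

Section Product.
Variable k : nat.

Definition zqt i j : fps3 := zvar * qvar ^+ i * tvar ^+ j.

Definition euler_factor i j : fps3 :=
  1 / (1 - zqt i j) ^+ ('C(k + i - 1, i) * 'C(k + j - 1, j)).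

Lemma zqtX i j m :
  zqt i j ^+ m = zvar ^+ m * qvar ^+ (i * m) * tvar ^+ (j * m).
Proof. by rewrite !exprMn !exprM. Qed.

Lemma one_sub_zqt_unit i j : 1 - zqt i j \is a GRing.unit.
Proof.
(* The monomial is [z] times a constant in [z], so the geometric series in [z] applies. *)
rewrite /zqt -mulrA /qvar /tvar -!fpsC_exp -fpsC_mul; exact: fps_geom_unit.
Qed.

(** The power is the single monomial [z^m q^(im) t^(jm)], which is invisible as soon as one exponent
    exceeds its bound. *)
Lemma cong3_one_sub_zqtX a b c i j m :
  [|| (a < m)%N, (b < i * m)%N | (c < j * m)%N] ->
  cong3 a b c (1 - zqt i j ^+ m) 1.
Proof.
move=> big_m a' b' c' la lb lc.
rewrite !fps_coefB zqtX fps3_coef_monomial.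
case: and3P => [[/eqP ea /eqP eb /eqP ec]|_]; last by rewrite subr0.
by move: big_m; rewrite -eb -ec -ea !ltnNge la lb lc.
Qed.

(** By telescoping, [1 - x] times the sum of [x^m] for [m <= n] is [1 - x^(n+1)], and the last power
    has [z]-degree [n+1], beyond the truncation. *)
Lemma euler_factor_geom n b c i j : cong3 n b c (euler_factor i j)
  ((\sum_(m < n.+1) zqt i j ^+ m) ^+ ('C(k + i - 1, i) * 'C(k + j - 1, j))).
Proof.
rewrite /euler_factor mul1r; set e := (_ * _)%N; apply: cong3V.
  by rewrite unitrX // one_sub_zqt_unit.
rewrite -exprMn -[X in cong3 _ _ _ _ X](expr1n _ e); apply: cong3X.
have -> : (1 - zqt i j) * \sum_(m < n.+1) zqt i j ^+ m = 1 - zqt i j ^+ n.+1.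
  by rewrite -opprB mulNr -subrX1 opprB.
by apply: cong3_one_sub_zqtX; rewrite ltnSn.
Qed.

Lemma euler_factor_cong1 a b c i j :
  (b < i)%N || (c < j)%N -> cong3 a b c (euler_factor i j) 1.
Proof.
move=> ij; rewrite /euler_factor mul1r; set e := (_ * _)%N; apply: cong3V.
  by rewrite unitrX // one_sub_zqt_unit.
rewrite mulr1 -[X in cong3 _ _ _ _ X](expr1n _ e); apply: cong3X.
by rewrite -[zqt i j]expr1; apply: cong3_one_sub_zqtX; rewrite !muln1 ij orbT.
Qed.

Lemma euler_inner_cauchy i : infprod_cauchy (euler_factor i).
Proof.
move=> a b c; exists c.+1 => j lcj.
by apply: euler_factor_cong1; rewrite lcj orbT.
Qed.

Lemma euler_inner_cong1 a b c i :
  (b < i)%N -> cong3 a b c (infprod (euler_factor i)) 1.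
Proof.
move=> lbi; apply: cong3_trans.
  apply: (@infprod_cong3 _ _ _ _ c.+1 (euler_inner_cauchy i)) => j lcj.
  by apply: euler_factor_cong1; rewrite lcj orbT.
apply: (@cong3_trans _ _ _ (\prod_(j < c.+1) 1)).
  by apply: cong3_prod => j _; apply: euler_factor_cong1; rewrite lbi.
by rewrite big1_eq; apply: cong3_refl.
Qed.

(** Three truncations combine: [q]-degree cuts the outer product at [b], [t]-degree the inner ones
    at [c], and [z]-degree the geometric series at [a]. *)
Lemma euler_product_cong a b c :
  cong3 a b c (infprod (fun i => infprod (euler_factor i)))
    (\prod_(i < b.+1) \prod_(j < c.+1) (\sum_(m < a.+1) zqt i j ^+ m)
        ^+ ('C(k + i - 1, i) * 'C(k + j - 1, j))).
Proof.
apply: cong3_trans.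
  apply: (@infprod_cong3 _ _ _ _ b.+1) => [a' b' c'|i lbi].
    by exists b'.+1 => i; apply: euler_inner_cong1.
  exact: euler_inner_cong1.
apply: cong3_prod => i _; apply: cong3_trans.
  apply: (@infprod_cong3 _ _ _ _ c.+1 (euler_inner_cauchy i)) => j lcj.
  by apply: euler_factor_cong1; rewrite lcj orbT.
by apply: cong3_prod => j _; apply: euler_factor_geom.
Qed.

(** * Coefficients as numbers of multisets of exponent vectors *)

Local Notation weights r := ('X_{1..k < r.+1} * 'X_{1..k < r.+1})%type.

(* Multisets of n pairs of exponent vectors, given by their multiplicities;
   vectors of degree above r cannot occur, so bounding degrees loses nothing. *)
Definition mults n r : {set {ffun weights r -> 'I_n.+1}} :=
  [set mu : {ffun weights r -> 'I_n.+1} |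
    [&& (\sum_(d : weights r) mu d == n)%N,
        (\sum_(d : weights r) mdeg d.1 * mu d == r)%N
      & (\sum_(d : weights r) mdeg d.2 * mu d == r)%N]].

(** Stars and bars, through the known size of the list [basis] of exponent vectors of degree [i];
    [i <= r] ensures that all of them fit in the bounded type. *)
Lemma card_mdeg i r : (0 < k)%N -> (i <= r)%N ->
  #|[pred a : 'X_{1..k < r.+1} | mdeg a == i]| = 'C(k + i - 1, i).
Proof.
case: k => // k' _ le_ir; rewrite addSn subn1 /= addnC -size_basis.
rewrite cardE -(size_map (@bmnm _ _)); apply/perm_size/uniq_perm.
- by rewrite map_inj_uniq ?enum_uniq //; apply: val_inj.
- exact: uniq_basis.
move=> m; rewrite -basis_cover; apply/mapP/eqP => [[a]|dm].
  by rewrite mem_enum inE => /eqP da ->.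
have lt_m : (mdeg m < r.+1)%N by rewrite dm.
by exists (BMultinom lt_m); rewrite // mem_enum inE /= dm.
Qed.

(** Grouping vectors by degree is what turns the binomial exponents into one factor per exponent
    vector. *)
Lemma prod_mdeg r (h : nat -> fps3) : (0 < k)%N ->
  \prod_(a : 'X_{1..k < r.+1}) h (mdeg a)
    = \prod_(i < r.+1) h i ^+ 'C(k + i - 1, i).
Proof.
move=> k0; rewrite (partition_big (fun a => Ordinal (bmdeg a)) xpredT) //=.
apply: eq_bigr => i _; rewrite -(card_mdeg k0 (leq_ord i)) -prodr_const.
by apply: eq_big => [a|a /eqP <-].
Qed.

Lemma prod_mdeg_pair r (g : nat -> nat -> fps3) : (0 < k)%N ->
  \prod_(d : weights r) g (mdeg d.1) (mdeg d.2)
    = \prod_(i < r.+1) \prod_(j < r.+1)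
        g i j ^+ ('C(k + i - 1, i) * 'C(k + j - 1, j)).
Proof.
move=> k0.
rewrite -(pair_bigA _ (fun a b : 'X_{1..k < r.+1} => g (mdeg a) (mdeg b))) /=.
rewrite (@prod_mdeg r (fun i => \prod_(b : 'X_{1..k < r.+1}) g i (mdeg b)) k0).
apply: eq_bigr => i _; rewrite (@prod_mdeg r (g i) k0) -prodrXl.
by apply: eq_bigr => j _; rewrite -exprM mulnC.
Qed.

(** By distributivity, picking one term of each geometric sum is picking a multiplicity for each
    [d], that is, a multiset. *)
Lemma prod_geom_expand (R : comNzRingType) (z q t : R) (D : finType)
    (u v : D -> nat) n :
  \prod_d \sum_(m < n.+1) (z * q ^+ u d * t ^+ v d) ^+ m
  = \sum_(mu : {ffun D -> 'I_n.+1}) z ^+ (\sum_d mu d)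
      * q ^+ (\sum_d u d * mu d) * t ^+ (\sum_d v d * mu d).
Proof.
rewrite bigA_distr_bigA; apply: eq_bigr => mu _.
rewrite -!prodrXr -!big_split /=; apply: eq_bigr => d _.
by rewrite !exprMn !exprM.
Qed.

Lemma euler_product_coef n r : (0 < k)%N ->
  infprod (fun i => infprod (euler_factor i)) n r r = #|mults n r|%:Z.
Proof.
move=> k0; rewrite (@euler_product_cong n r r n r r) ?leqnn //.
rewrite -(@prod_mdeg_pair r (fun i j => \sum_(m < n.+1) zqt i j ^+ m) k0).
rewrite (@prod_geom_expand fps3 zvar qvar tvar (weights r)
  (fun d => mdeg d.1) (fun d => mdeg d.2) n).
rewrite !fps_coef_sum -sum1_card -natz natr_sum [RHS]big_mkcond /=.
apply: eq_bigr => mu _; rewrite fps3_coef_monomial inE.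
rewrite ![r == _]eq_sym [n == _]eq_sym.
by case: [&& _, _ & _].
Qed.

End Product.

(** * Orbits of pairs of monomials *)

Section FiberMults.
Variables (n : nat) (D : finType).
Implicit Types f g : 'I_n -> D.

(** The multiset of values of [f], a complete invariant under permutations of the arguments. [inord]
    loses nothing, as a fibre has at most [n] points. *)
Definition fiber_mults f : {ffun D -> 'I_n.+1} :=
  [ffun d => inord #|[pred i | f i == d]|].

Lemma fiber_multsE f d : fiber_mults f d = #|[pred i | f i == d]| :> nat.
Proof. by rewrite ffunE inordK // ltnS (leq_trans (max_card _)) ?card_ord. Qed.

Lemma fiber_mults_count f d :
  fiber_mults f d = count_mem d (codom f) :> nat.
Proof.
rewrite fiber_multsE codomE count_map enumT cardE /enum_mem size_filter.
exact: eq_count.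
Qed.

Lemma sum_fiber_mults f (w : D -> nat) :
  (\sum_d w d * fiber_mults f d = \sum_i w (f i))%N.
Proof.
rewrite [RHS](partition_big f xpredT) //=; apply: eq_bigr => d _.
rewrite fiber_multsE mulnC -sum_nat_const.
by apply: eq_big => // i /eqP ->.
Qed.

Lemma fiber_mults_perm f (s : 'S_n) : fiber_mults (f \o s) = fiber_mults f.
Proof.
apply/ffunP => d; rewrite !ffunE; congr inord.
rewrite -(card_image (@perm_inj _ s)); apply: eq_card => i.
apply/imageP/idP => [[j + ->] //|fi].
by exists (s^-1 i)%g; rewrite ?permKV // inE /= permKV.
Qed.

(** Equal multiplicities make the two lists of values permutations of each other. *)
Lemma fiber_mults_inj f g :
  fiber_mults f = fiber_mults g -> exists s : 'S_n, g =1 f \o s.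
Proof.
move=> fg; have /tuple_permP[s gs] : perm_eq (mktuple g) (mktuple f).
  apply/allP => d _ /=; apply/eqP.
  by move/ffunP/(_ d)/(congr1 val): fg; rewrite /= !fiber_mults_count !codomE.
exists s => i; have := congr1 (fun t => nth (g i) t i) gs.
by rewrite !nth_mktuple tnth_mktuple.
Qed.

Lemma fiber_mults_onto (mu : {ffun D -> 'I_n.+1}) :
  (\sum_d mu d = n)%N -> exists f, fiber_mults f = mu.
Proof.
(* Listing each [d] with [mu d] repetitions gives a word of length [n], read as a function on
   ['I_n]. *)
move=> sum_mu; pose s := flatten [seq nseq (mu d) d | d <- index_enum D].
have size_s : size s == n.
  rewrite size_flatten /shape -map_comp sumnE big_map -[in X in _ == X]sum_mu.
  by apply/eqP/eq_bigr => d _; rewrite /= size_nseq.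
exists (tnth (Tuple size_s)); apply/ffunP => d; apply: val_inj.
rewrite /= fiber_mults_count codomE map_tnth_enum /=.
rewrite count_flatten sumnE !big_map (bigD1 d) //=.
rewrite count_nseq /= eqxx mul1n big1 ?addn0 // => e ne_ed.
by rewrite count_nseq /= (negbTE ne_ed).
Qed.

End FiberMults.

(** * Monomials as n-tuples of rows and their permutation *)

Section Monomials.
Variables n k : nat.
Implicit Types (m : 'X_{1..n * k}) (s : 'S_n).

Definition row_mnm m (i : 'I_n) : 'X_{1..k} :=
  [multinom m (mxvec_index i j) | j < k].

Definition rows_mnm (x : 'I_n -> 'X_{1..k}) : 'X_{1..n * k} :=
  [multinom mxvec (\matrix_(i, j) x i j) ord0 l | l < n * k].

Lemma rows_mnmE x i j : rows_mnm x (mxvec_index i j) = x i j.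
Proof. by rewrite mnmE mxvecE mxE. Qed.

Lemma rows_mnmK x i : row_mnm (rows_mnm x) i = x i.
Proof. by apply/mnmP => j; rewrite mnmE rows_mnmE. Qed.

Lemma row_mnm_inj m m' : row_mnm m =1 row_mnm m' -> m = m'.
Proof.
move=> eq_row; apply/mnmP => l; case/mxvec_indexP: l => i j.
by move/mnmP/(_ j): (eq_row i); rewrite !mnmE.
Qed.

Lemma big_mxvec_index (R : Type) (idx : R) (op : Monoid.com_law idx)
    (G : 'I_(n * k) -> R) :
  \big[op/idx]_l G l = \big[op/idx]_i \big[op/idx]_j G (mxvec_index i j).
Proof.
rewrite pair_bigA /= (reindex _ (curry_mxvec_bij n k)) /=.
by apply: eq_bigr => -[].
Qed.

Lemma mdeg_row m : mdeg m = (\sum_i mdeg (row_mnm m i))%N.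
Proof.
rewrite mdegE big_mxvec_index; apply: eq_bigr => i _; rewrite mdegE.
by apply: eq_bigr => j _; rewrite mnmE.
Qed.

(** The inverse appears because substituting [x_(s i, j)] for [x_(i, j)] moves row [i] to position
    [s i]. *)
Definition mnm_act s m := rows_mnm (row_mnm m \o (s^-1)%g).

Lemma row_mnm_act s m i : row_mnm (mnm_act s m) i = row_mnm m ((s^-1)%g i).
Proof. exact: rows_mnmK. Qed.

Lemma mnm_act_inj s : injective (mnm_act s).
Proof.
move=> m m' eq_s; apply: row_mnm_inj => i.
by rewrite -(permK s i) -!row_mnm_act eq_s.
Qed.

Lemma mdeg_act s m : mdeg (mnm_act s m) = mdeg m.
Proof.
rewrite !mdeg_row (reindex_inj (@perm_inj _ s)) /=.
by apply: eq_bigr => i _; rewrite row_mnm_act permK.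
Qed.

Lemma poly_actX (F : fieldType) s m :
  poly_act s 'X_[m] = 'X_[mnm_act s m] :> {mpoly F[n * k]}.
Proof.
rewrite /poly_act comp_mpolyX [RHS]mpolyXE_id !big_mxvec_index /=.
rewrite [RHS](reindex_inj (@perm_inj _ s)) /=.
apply: eq_bigr => i _; apply: eq_bigr => j _.
by rewrite tnth_mktuple mxvecE mxE rows_mnmE /= permK mnmE.
Qed.

Lemma mcoeff_poly_act (F : fieldType) s (p : {mpoly F[n * k]}) m :
  (poly_act s p)@_(mnm_act s m) = p@_m.
Proof.
have -> : poly_act s p = \sum_(m' <- msupp p) p@_m' *: 'X_[mnm_act s m'].
  rewrite {1}[p]mpolyE /poly_act linear_sum.
  by apply: eq_bigr => m' _; rewrite linearZ -poly_actX.
rewrite [in RHS](mpolyE p) !raddf_sum /=; apply: eq_bigr => m' _.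
by rewrite !mcoeffZ !mcoeffX (inj_eq (@mnm_act_inj s)).
Qed.

End Monomials.

(** * Equivariant endomorphisms as functions on orbits *)

Section OrbitBasis.
Variables (F : fieldType) (n k r : nat).
Local Notation V := (hpoly F n k r).
Local Notation weights := ('X_{1..k < r.+1} * 'X_{1..k < r.+1})%type.
Local Notation mults := (mults k n r).
Implicit Types (m : 'X_{1..n * k}) (s : 'S_n).

Lemma mdeg_row_lt m i : mdeg m = r -> (mdeg (row_mnm m i) < r.+1)%N.
Proof. by move=> <-; rewrite mdeg_row ltnS (bigD1 i) //= leq_addr. Qed.

Definition brow m i : 'X_{1..k < r.+1} := insubd bm0 (row_mnm m i).

Lemma browK m i : mdeg m = r -> brow m i = row_mnm m i :> 'X_{1..k}.
Proof. by move=> dm; rewrite /brow insubdK //; apply: mdeg_row_lt. Qed.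

(** The invariant separating the orbits of pairs: the multiset of pairs of corresponding rows. *)
Definition pair_type m m' := fiber_mults (fun i => (brow m i, brow m' i)).

Lemma pair_type_mults m m' :
  mdeg m = r -> mdeg m' = r -> pair_type m m' \in mults.
Proof.
move=> dm dm'; rewrite inE; apply/and3P; split; apply/eqP.
- have := sum_fiber_mults (fun i => (brow m i, brow m' i)) (fun=> 1%N).
  rewrite sum1_card card_ord => sum1; apply: etrans sum1.
  by apply: eq_bigr => d _; rewrite mul1n.
- rewrite (sum_fiber_mults _ (fun d : weights => mdeg d.1)).
  apply: etrans (dm); rewrite mdeg_row.
  by apply: eq_bigr => i _; rewrite /= browK.
rewrite (sum_fiber_mults _ (fun d : weights => mdeg d.2)).
apply: etrans (dm'); rewrite mdeg_row.
by apply: eq_bigr => i _; rewrite /= browK.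
Qed.

Lemma pair_type_act s m m' :
  pair_type (mnm_act s m) (mnm_act s m') = pair_type m m'.
Proof.
rewrite -[RHS](fiber_mults_perm _ (s^-1)%g); congr fiber_mults.
by apply/funext => i; rewrite /brow /= !row_mnm_act.
Qed.

Lemma pair_type_inj m1 m1' m2 m2' :
    mdeg m1 = r -> mdeg m1' = r -> mdeg m2 = r -> mdeg m2' = r ->
  pair_type m1 m1' = pair_type m2 m2' ->
  exists s, m2 = mnm_act s m1 /\ m2' = mnm_act s m1'.
Proof.
(* The matching [s] acts on row indices by precomposition, hence the group element is its
   inverse. *)
move=> d1 d1' d2 d2' /fiber_mults_inj[s eq_s]; exists (s^-1)%g.
split; apply: row_mnm_inj => i; rewrite row_mnm_act invgK.
  by have [/(congr1 val)] := eq_s i; rewrite /= !browK.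
by have [_ /(congr1 val)] := eq_s i; rewrite /= !browK.
Qed.

Lemma pair_type_onto mu : mu \in mults ->
  exists m m', [/\ mdeg m = r, mdeg m' = r & pair_type m m' = mu].
Proof.
rewrite inE => /and3P[/eqP/fiber_mults_onto[f <-] /eqP w1 /eqP w2].
pose m1 := rows_mnm (fun i => (f i).1); pose m2 := rows_mnm (fun i => (f i).2).
have d1 : mdeg m1 = r.
  apply: etrans w1.
  rewrite (sum_fiber_mults _ (fun d : weights => mdeg d.1)) mdeg_row.
  by apply: eq_bigr => i _; rewrite rows_mnmK.
have d2 : mdeg m2 = r.
  apply: etrans w2.
  rewrite (sum_fiber_mults _ (fun d : weights => mdeg d.2)) mdeg_row.
  by apply: eq_bigr => i _; rewrite rows_mnmK.
exists m1, m2; split; [exact: d1 | exact: d2 |].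
congr fiber_mults; apply/funext => i.
rewrite [RHS]surjective_pairing.
by congr pair; apply: val_inj; rewrite /= browK // rows_mnmK.
Qed.

Definition hmono m : V := insubd 0 'X_[m].

Lemma hmonoE m : mdeg m = r -> hmono m = 'X_[m] :> {mpoly F[n * k]}.
Proof.
move=> dm; suff: val (hmono m) = 'X_[m] by [].
by rewrite insubdK // unfold_in /= -/(_ \is _) dhomogX /= dm.
Qed.

Lemma mcoeff_hmono m m' : mdeg m = r -> (hmono m)@_m' = (m == m')%:R.
Proof. by move=> dm; rewrite hmonoE // mcoeffX. Qed.

Lemma hpoly_coefZ c (p : V) m : (c *: p)@_m = c * p@_m.
Proof. exact: mcoeffZ. Qed.

Lemma hpoly_coef_sum I (s : seq I) (P : pred I) (p : I -> V) m :
  (\sum_(i <- s | P i) p i)@_m = \sum_(i <- s | P i) (p i)@_m.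
Proof. by rewrite !raddf_sum. Qed.

Lemma hpoly_act_hmono s m :
  mdeg m = r -> hpoly_act s (hmono m) = hmono (mnm_act s m).
Proof.
move=> dm; apply: val_inj.
by rewrite /= !hmonoE ?mdeg_act // poly_actX.
Qed.

Lemma hpoly_eqP (p q : V) :
  (forall m, mdeg m = r -> p@_m = q@_m) -> p = q.
Proof.
move=> pq; apply/val_inj/mpolyP => m /=.
have [dm|dm] := eqVneq (mdeg m) r; first exact: pq.
by rewrite !(dhomog_nemf_coeff (dhomog_is_dhomog _) dm).
Qed.

Lemma lfun_hmonoP (f g : 'End(V)) :
  (forall m, mdeg m = r -> f (hmono m) = g (hmono m)) -> f = g.
Proof.
move=> fg; apply/lfunP => p.
have -> : p = \sum_(m : 'X_{1..(n * k) < r.+1} | mdeg m == r) p@_m *: hmono m.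
  apply: hpoly_eqP => m dm; rewrite hpoly_coef_sum.
  have lt_m : (mdeg m < r.+1)%N by rewrite dm.
  rewrite (bigD1 (BMultinom lt_m)) ?dm //= hpoly_coefZ (mcoeff_hmono _ dm).
  rewrite eqxx mulr1 big1 ?addr0 // => a /andP[/eqP da ne_a].
  by rewrite hpoly_coefZ (mcoeff_hmono _ da) [_ == m](negbTE ne_a) mulr0.
by rewrite !linear_sum; apply: eq_bigr => m /eqP dm; rewrite !linearZ /= fg.
Qed.

(** A matrix entry depending only on the orbit of the pair; [v] has one coordinate per orbit. *)
Definition orbit_coef (v : 'rV[F]_#|mults|) m m' : F :=
  \sum_l v 0 l *+ (pair_type m m' == enum_val l).

Lemma orbit_coefE v m m' l :
  pair_type m m' = enum_val l -> orbit_coef v m m' = v 0 l.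
Proof.
move=> ml; rewrite /orbit_coef ml (bigD1 l) //= eqxx mulr1n big1 ?addr0 // => j.
by rewrite (inj_eq enum_val_inj) eq_sym => /negbTE ->.
Qed.

Definition orbit_op v (p : V) : V :=
  \sum_(m : 'X_{1..(n * k) < r.+1} | mdeg m == r)
    \sum_(m' : 'X_{1..(n * k) < r.+1} | mdeg m' == r)
      (p@_m * orbit_coef v m m') *: hmono m'.

Fact orbit_op_is_linear v : linear (orbit_op v).
Proof.
move=> a p q; rewrite /orbit_op scaler_sumr -big_split /=.
apply: eq_bigr => m _; rewrite scaler_sumr -big_split /=.
apply: eq_bigr => m' _; rewrite mcoeffD mcoeffZ.
by rewrite scalerA -scalerDl mulrDl mulrA.
Qed.

HB.instance Definition _ v :=
  GRing.isLinear.Build F V V _ (orbit_op v) (orbit_op_is_linear v).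

Lemma mcoeff_orbit_op v m m' : mdeg m = r -> mdeg m' = r ->
  (orbit_op v (hmono m))@_m' = orbit_coef v m m'.
Proof.
move=> dm dm'; have lt_m : (mdeg m < r.+1)%N by rewrite dm.
have lt_m' : (mdeg m' < r.+1)%N by rewrite dm'.
rewrite /orbit_op hpoly_coef_sum (bigD1 (BMultinom lt_m)) ?dm //=.
rewrite [X in _ + X]big1 ?addr0; last first.
  move=> a /andP[/eqP da ne_a]; rewrite big1 ?mcoeff0 // => a' _.
  rewrite (mcoeff_hmono _ dm) eq_sym [_ == m](negbTE ne_a).
  by rewrite mul0r scale0r.
rewrite hpoly_coef_sum (bigD1 (BMultinom lt_m')) ?dm' //=.
rewrite [X in _ + X]big1 ?addr0; last first.
  move=> a /andP[/eqP da ne_a].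
  by rewrite hpoly_coefZ (mcoeff_hmono _ da) [_ == m'](negbTE ne_a) mulr0.
rewrite hpoly_coefZ (mcoeff_hmono _ dm) (mcoeff_hmono _ dm').
by rewrite !eqxx mul1r mulr1.
Qed.

Definition orbit_end v : 'End(V) := linfun (orbit_op v).

Fact orbit_end_is_linear : linear orbit_end.
Proof.
move=> a u v; apply: lfun_hmonoP => m dm; apply: hpoly_eqP => m' dm'.
rewrite add_lfunE scale_lfunE !lfunE /= mcoeffD mcoeffZ !mcoeff_orbit_op //.
rewrite /orbit_coef mulr_sumr -big_split /=; apply: eq_bigr => l _.
by rewrite !mxE mulrnDl mulrnAr.
Qed.

HB.instance Definition _ :=
  GRing.isLinear.Build F 'rV[F]_#|mults| 'End(V) _ orbit_end
    orbit_end_is_linear.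

Lemma mcoeff_hpoly_act s (p : V) m : (hpoly_act s p)@_(mnm_act s m) = p@_m.
Proof. exact: mcoeff_poly_act. Qed.

Lemma mnm_actK s m : mnm_act s (mnm_act s^-1%g m) = m.
Proof. by apply: row_mnm_inj => i; rewrite !row_mnm_act invgK permKV. Qed.

Lemma orbit_end_equivariant v : orbit_end v \in equivariant_End F n k r.
Proof.
apply/equivariant_EndP => s p.
suff /lfunP/(_ p) : (orbit_end v \o linfun (hpoly_act s)
    = linfun (hpoly_act s) \o orbit_end v)%VF.
  by rewrite !comp_lfunE (lfunE _ p) (lfunE _ (orbit_end v p)).
apply: lfun_hmonoP => m dm; apply: hpoly_eqP => m' dm'.
(* Writing the target monomial as an [s]-image moves both monomials by the same [s], and [pair_type]
   is invariant. *)
rewrite !comp_lfunE !lfunE /= (hpoly_act_hmono s dm) -(mnm_actK s m').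
set m2 := mnm_act _ m'; have d2 : mdeg m2 = r by rewrite mdeg_act.
rewrite [RHS]mcoeff_hpoly_act [RHS](mcoeff_orbit_op v dm d2).
rewrite [LHS]mcoeff_orbit_op; try by rewrite mdeg_act.
by rewrite /orbit_coef pair_type_act.
Qed.

Lemma orbit_end_inj : injective orbit_end.
Proof.
move=> u v eq_uv; apply/rowP => l.
have [m [m' [dm dm' ml]]] := pair_type_onto (enum_valP l).
rewrite -!(orbit_coefE _ ml) -!mcoeff_orbit_op //.
by move/lfunP/(_ (hmono m)): eq_uv; rewrite !lfunE => ->.
Qed.

Lemma orbit_end_onto f :
  f \in equivariant_End F n k r -> exists v, f = orbit_end v.
Proof.
move=> /equivariant_EndP fA.
have /choice[e eP] (l : 'I_#|mults|) : exists e : 'X_{1..n * k} * 'X_{1..n * k},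
    [/\ mdeg e.1 = r, mdeg e.2 = r & pair_type e.1 e.2 = enum_val l].
  have [m [m' ?]] := pair_type_onto (enum_valP l); by exists (m, m').
(* Each coordinate is the matrix entry of [f] at a chosen representative of the orbit; equivariance
   carries it to the whole orbit. *)
exists (\row_l (f (hmono (e l).1))@_((e l).2)).
apply: lfun_hmonoP => m dm; apply: hpoly_eqP => m' dm'.
rewrite lfunE mcoeff_orbit_op //.
have mm' := pair_type_mults dm dm'.
have ml : pair_type m m' = enum_val (enum_rank_in mm' (pair_type m m')).
  by rewrite enum_rankK_in.
rewrite (orbit_coefE _ ml) mxE; set l := enum_rank_in _ _ in ml *.
have [d1 d2 el] := eP l.
have [s [-> ->]] := pair_type_inj d1 d2 dm dm' (etrans el (esym ml)).
by rewrite -hpoly_act_hmono // fA mcoeff_hpoly_act.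
Qed.

(** [orbit_end] is a linear injection of the row space with one coordinate per orbit, and its image
    is exactly the commutant. *)
Lemma dim_equivariant_End : \dim (equivariant_End F n k r) = #|mults|.
Proof.
have -> : equivariant_End F n k r = limg (linfun orbit_end).
  apply/vspaceP => f; apply/idP/memv_imgP => [/orbit_end_onto[v ->]|[v _ ->]].
    by exists v; rewrite ?memvf // lfunE.
  by rewrite lfunE /= orbit_end_equivariant.
rewrite limg_dim_eq; first by rewrite dimvf dim_matrix; exact: mul1n.
apply/eqP; rewrite capfv; apply/lker0P => u v.
by rewrite !lfunE; apply: orbit_end_inj.
Qed.

End OrbitBasis.
Theorem corollary5p4 (R : realType) (n k r : nat) :
  (0 < n)%N -> (0 < k)%N -> (0 < r)%N ->
  (\dim (equivariant_End R[i] n k r))%:Z =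
  infprod (fun i : nat => infprod (fun j : nat =>
    1 / (1 - zvar * qvar ^+ i * tvar ^+ j)
          ^+ ('C(k + i - 1, i) * 'C(k + j - 1, j)))) n r r.
Proof.
move=> _ k0 _; rewrite dim_equivariant_End.
exact/esym/(euler_product_coef n r k0).
Qed.
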